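(* Let $R$ be a ring and let $\Sigma=\{\sigma_1,\dots,\sigma_n\}$ be a finite family of injective endomorphisms of $R$. Then $R$ is $\Sigma$-semicommutative and reduced if and only if $R$ is $\Sigma$-rigid.
   Context: Rings are associative with identity; $\mathbb{N}$ includes $0$. Endomorphisms are additive and multiplicative, and are not required a priori to preserve $1$. For $\alpha=(\alpha_1,\dots,\alpha_n)\in\mathbb{N}^n$, $\sigma^\alpha:=\sigma_1^{\alpha_1}\circ\cdots\circ\sigma_n^{\alpha_n}$ (with $\sigma_i^0=\mathrm{id}_R$). $R$ is $\Sigma$-semicommutative if for all $a,b\in R$, $ab=0$ implies $aR\sigma^\alpha(b)=0$ for every $\alpha\in\mathbb{N}^n\setminus\{0\}$. $R$ is $\Sigma$-rigid if for every $a\in R$ and every $\alpha\in\mathbb{N}^n$, $a\sigma^\alpha(a)=0$ implies $a=0$. $R$ is reduced if it has no nonzero nilpotent elements. *)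

(* Defs.v *)
From HB Require Import structures.
From mathcomp Require Import all_boot all_order all_algebra.

Set Implicit Arguments.
Unset Strict Implicit.
Unset Printing Implicit Defensive.

Import GRing.Theory.
Local Open Scope ring_scope.

(* The indices 1, ..., n become 0, ..., n-1.  The big operator folds to the
   right, so this is sigma_0^(alpha_0) \o ... \o sigma_(n-1)^(alpha_(n-1)): the
   map of largest index is applied first (the sigma_i need not commute). *)
Definition sigma_pow (R : pzRingType) (n : nat) (sigma : 'I_n -> R -> R)
    (alpha : {ffun 'I_n -> nat}) : R -> R :=
  \big[(fun f g : R -> R => f \o g)/(fun x => x)]_(i < n)
     iter (alpha i) (sigma i).

Definition semicommutative (R : pzRingType) (n : nat)
    (sigma : 'I_n -> R -> R) : Prop :=
  forall a b : R, a * b = 0 ->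
  forall alpha : {ffun 'I_n -> nat}, alpha <> 0 ->
  forall r : R, a * r * sigma_pow sigma alpha b = 0.

Definition rigid (R : pzRingType) (n : nat) (sigma : 'I_n -> R -> R) : Prop :=
  forall (a : R) (alpha : {ffun 'I_n -> nat}),
  a * sigma_pow sigma alpha a = 0 -> a = 0.

Definition nilpotent_elt (R : pzRingType) (x : R) : Prop :=
  exists k : nat, x ^+ k = 0.

Definition reduced (R : pzRingType) : Prop :=
  forall x : R, nilpotent_elt x -> x = 0.

(* Main.v *)
Require Import Defs.
From HB Require Import structures.
From mathcomp Require Import all_boot all_order all_algebra.

Set Implicit Arguments.
Unset Strict Implicit.
Unset Printing Implicit Defensive.

Import GRing.Theory.
Local Open Scope ring_scope.

(** Every composite [s := sigma_pow sigma alpha] is again multiplicative,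
    injective and zero-preserving, and this is all that the argument needs to
    know about it.  The other ingredient is that a product which vanishes in a
    reduced ring also vanishes with its two factors swapped ([reduced_mul0C]).

    From left to right, let [a * s a = 0] with [alpha] nonzero.  Swapping gives
    [s a * a = 0], and semicommutativity applied to this product inserts [s]
    exactly where it makes both factors equal: [s a * 1 * s a = 0].  Hence
    [s a = 0] as the ring is reduced, and [a = 0] by injectivity.  For
    [alpha = 0] the hypothesis is [a * a = 0].

    From right to left, rigidity at [alpha = 0] makes the ring reduced.  If
    [a * b = 0], then [b * a = 0], and for [y := a * r * s b] the product
    [y * s y] contains the factor [s b * s a = s (b * a) = 0]; rigidity gives
    [y = 0]. *)

Section SigmaPow.

Variables (R : pzRingType) (n : nat) (sigma : 'I_n -> R -> R).

Lemma sigma_pow0 x : sigma_pow sigma 0 x = x.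
Proof.
rewrite /sigma_pow; elim/big_ind: _ => // [f g fx gx | i _].
  by rewrite /= gx.
by rewrite ffunE.
Qed.

Lemma sigma_pow_eq0 alpha :
  (forall i, sigma i 0 = 0) -> sigma_pow sigma alpha 0 = 0.
Proof.
move=> sigma0; rewrite /sigma_pow; elim/big_ind: _ => // [f g f0 g0 | i _].
  by rewrite /= g0.
by elim: (alpha i) => //= m ->.
Qed.

Lemma sigma_powM alpha :
  (forall i, {morph sigma i : x y / x * y}) ->
  {morph sigma_pow sigma alpha : x y / x * y}.
Proof.
move=> sigmaM; rewrite /sigma_pow.
elim/big_ind: _ => // [f g fM gM x y | i _ x y].
  by rewrite /= gM fM.
by elim: (alpha i) => //= m ->; rewrite sigmaM.
Qed.

Lemma sigma_pow_inj alpha :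
  (forall i, injective (sigma i)) -> injective (sigma_pow sigma alpha).
Proof.
move=> sigma_inj; rewrite /sigma_pow.
elim/big_ind: _ => // [f g f_inj g_inj | i _]; first exact: inj_comp.
by elim: (alpha i) => //= m IHm x y /sigma_inj /IHm.
Qed.

End SigmaPow.

Section Reduced.

Variable R : pzRingType.

Lemma reduced_sqr0 (x : R) : reduced R -> x * x = 0 -> x = 0.
Proof. by move=> redR xx0; apply: redR; exists 2; rewrite expr2. Qed.

(** If [x ^+ k.+1 = 0] with [0 < k], then [x ^+ k] squares to zero because
    [k.+1 <= 2 * k]; so the nilpotency exponent can be lowered one by one. *)
Lemma sqr0_reduced : (forall x : R, x * x = 0 -> x = 0) -> reduced R.
Proof.
move=> sqr0 x [k]; elim: k => [|[|k] IHk] xk0.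
- by rewrite -[x]mulr1 -(expr0 x) xk0 mulr0.
- by rewrite -[x]expr1.
- by apply/IHk/sqr0; rewrite -exprD -addSnnS exprD xk0 mul0r.
Qed.

(** [b * a] squares to [b * (a * b) * a]. *)
Lemma reduced_mul0C (a b : R) : reduced R -> a * b = 0 -> b * a = 0.
Proof.
move=> redR ab0; apply: reduced_sqr0 => //.
by rewrite mulrA -(mulrA b) ab0 mulr0 mul0r.
Qed.

End Reduced.

Lemma rigid_reduced (R : pzRingType) (n : nat) (sigma : 'I_n -> R -> R) :
  rigid sigma -> reduced R.
Proof.
move=> rig; apply: sqr0_reduced => x xx0.
by apply: (rig x 0); rewrite sigma_pow0.
Qed.

Theorem theorem3p11 (R : pzRingType) (n : nat)
    (sigma : 'I_n -> {additive R -> R})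
    (sigmaM : forall i : 'I_n, {morph sigma i : x y / x * y})
    (sigma_inj : forall i : 'I_n, injective (sigma i)) :
  (semicommutative sigma /\ reduced R) <-> rigid sigma.
Proof.
have sM alpha := sigma_powM alpha sigmaM.
have s_inj alpha := sigma_pow_inj (alpha := alpha) sigma_inj.
have s0 alpha : sigma_pow sigma alpha 0 = 0.
  by apply: sigma_pow_eq0 => i; rewrite raddf0.
split=> [[semR redR] a alpha asa0 | rig].
  have [alpha0 | /eqP alpha_neq0] := eqVneq alpha 0.
    by apply: reduced_sqr0 => //; rewrite alpha0 sigma_pow0 in asa0.
  apply: (s_inj alpha); rewrite s0; apply: reduced_sqr0 => //.
  have := semR _ _ (reduced_mul0C redR asa0) alpha alpha_neq0 1.
  by rewrite mulr1.
have redR := rigid_reduced rig.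
split=> // a b ab0 alpha _ r; apply: (rig _ alpha).
have ba0 := reduced_mul0C redR ab0.
by rewrite !sM !mulrA -(mulrA (a * r)) -sM ba0 s0 mulr0 !mul0r.
Qed.
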